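(* Let $T$ be a tree that contains a subgraph isomorphic to $T_{3,3}$. Then $\mathrm{lcapt}(T) \leq \left\lfloor \frac{\ell(T)}{2} \right\rfloor - 1$, where $\ell(T)$ is the number of leaves of $T$.
   Context: $T_{3,3}$ is the rooted tree of depth 2 whose root has exactly three children, each of which has exactly two children (leaves); it has 10 vertices. The localization game on a connected graph $G$ with $k$ cops: the robber first chooses a starting vertex (invisible to the cops; the robber knows the cops' strategy). Then rounds are played; in each round the cops choose (probe) any $k$ vertices $c_1,\dots,c_k$ of $G$ and learn $(d(c_1,r),\dots,d(c_k,r))$, where $r$ is the robber's current vertex; then the robber moves to a neighbor or stays put. The cops win if after finitely many rounds they can determine the robber's exact position. The localization number $\zeta(G)$ is the minimum $k$ for which the cops have a winning strategy. For $k \geq \zeta(G)$, $\mathrm{lcapt}_k(G)$ is the number of rounds (probes) needed for $k$ cops to determine the robber's location under optimal play (cops minimizing, robber maximizing), and $\mathrm{lcapt}(G) = \mathrm{lcapt}_{\zeta(G)}(G)$. (A tree containing $T_{3,3}$ has $\zeta(T)=2$.) *)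

(* Defs.v *)
From mathcomp Require Import all_boot.
From mathcomp Require Import boolp.

Set Implicit Arguments.
Unset Strict Implicit.
Unset Printing Implicit Defensive.

Record sgraph := SGraph {
  vertex :> finType;
  adj : rel vertex;
  adj_sym : symmetric adj;
  adj_irr : irreflexive adj }.

Section Graphs.
Variable G : sgraph.

Definition connected : Prop :=
  0 < #|G| /\ forall x y : G, connect (@adj G) x y.

(* [ucycle] also accepts the walk x, y, x along a single edge, hence the
   bound: a cycle of a simple graph has at least three vertices. *)
Definition acyclic : Prop :=
  forall c : seq G, ucycle (@adj G) c -> size c < 3.

Definition is_tree : Prop := connected /\ acyclic.

Definition degree (x : G) : nat := #|[set y | adj x y]|.

Definition leaves : {set G} := [set x | degree x == 1].

Definition walk_of_length (n : nat) (x y : G) : bool :=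
  [exists p : n.-tuple G, path (@adj G) x p && (last x p == y)].

(* The least length of a walk from x to y; it is at most #|G| - 1 when y is
   reachable from x, and [find] returns #|G| otherwise. *)
Definition dist (x y : G) : nat :=
  find (fun n => walk_of_length n x y) (iota 0 #|G|).

End Graphs.

Definition contains_copy (G H : sgraph) : Prop :=
  exists2 f : H -> G, injective f & forall u v : H, adj u v -> adj (f u) (f v).

(* T_{3,3}: [None] is the root, [Some (i, None)] its i-th child, and
   [Some (i, Some j)] the j-th child of the latter. *)
Definition T33_vertex : finType := option ('I_3 * option 'I_2).

Definition T33_parent (u v : T33_vertex) : bool :=
  match u, v with
  | None, Some (_, None) => true
  | Some (i, None), Some (j, Some _) => i == j
  | _, _ => false
  end.

Definition T33_adj : rel T33_vertex :=
  fun u v => T33_parent u v || T33_parent v u.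

Lemma T33_adj_sym : symmetric T33_adj.
Proof. by move=> u v; rewrite /T33_adj orbC. Qed.

Lemma T33_adj_irr : irreflexive T33_adj.
Proof. by case=> [[i [j|]]|]. Qed.

Definition T33 : sgraph := SGraph T33_adj_sym T33_adj_irr.

Section LocalizationGame.
Variable G : sgraph.

(* The next probe, as a function of the answers to all earlier probes. *)
Definition strategy (k : nat) := seq (k.-tuple nat) -> k.-tuple G.

(* r t is the position of the robber when the probe number t (counted from 0)
   is made. *)
Definition robber_walk (r : nat -> G) : Prop :=
  forall t, r t.+1 = r t \/ adj (r t) (r t.+1).

Fixpoint answers k (s : strategy k) (r : nat -> G) (t : nat) :
    seq (k.-tuple nat) :=
  if t is t'.+1 then
    let h := answers s r t' in
    rcons h [tuple of [seq dist c (r t') | c <- s h]]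
  else [::].

(* After the answer to probe number t, i.e. after t.+1 rounds, every robber
   compatible with the answers received so far stands on r t. *)
Definition located k (s : strategy k) (r : nat -> G) (t : nat) : Prop :=
  forall r' : nat -> G, robber_walk r' ->
    answers s r' t.+1 = answers s r t.+1 -> r' t = r t.

Definition winning_strategy k (s : strategy k) : Prop :=
  forall r, robber_walk r -> exists t, located s r t.

Definition cops_win (k : nat) : Prop := exists s : strategy k, winning_strategy s.

Definition wins_within k (s : strategy k) (m : nat) : Prop :=
  forall r, robber_walk r -> exists2 t, t < m & located s r t.

Definition cops_win_within (k m : nat) : Prop :=
  exists s : strategy k, wins_within s m.

Lemma dist_eq0 (x y : G) : dist x y = 0 -> x = y.
Proof.
have : 0 < #|G| by apply/card_gt0P; exists x.
rewrite /dist; case: #|G| => // n _ /=.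
case: ifP => // /existsP[p]; rewrite tuple0 /= => /eqP xy _.
exact: xy.
Qed.

Lemma distxx (x : G) : dist x x = 0.
Proof.
have : 0 < #|G| by apply/card_gt0P; exists x.
rewrite /dist; case: #|G| => // n _ /=.
suff -> : walk_of_length 0 x x by [].
by apply/existsP; exists [tuple]; rewrite /= eqxx.
Qed.

Lemma ex_cops_win : exists k, `[< cops_win k >].
Proof.
exists #|G|; apply/asboolP; exists (fun=> enum_tuple G) => r rr.
exists 0 => r' _ /= [] /(congr1 (fun s => nth 0 s (index (r 0) (enum G)))).
have re : r 0 \in enum G by rewrite mem_enum.
have ri : index (r 0) (enum G) < size (enum G) by rewrite index_mem.
move: (enum G) re ri => /= E re ri.
rewrite !(nth_map (r 0)) // nth_index // distxx.
by move/dist_eq0 => ->.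
Qed.

Definition localization_number : nat := ex_minn ex_cops_win.

Lemma localization_numberP : cops_win localization_number.
Proof. by rewrite /localization_number; case: ex_minnP => k /asboolP. Qed.

Lemma eq_answers k (s : strategy k) (r r' : nat -> G) t :
  (forall i, i < t -> r i = r' i) -> answers s r t = answers s r' t.
Proof.
elim: t => //= t IH rr'; rewrite IH => [|i it]; first by rewrite rr'.
exact/rr'/ltnW.
Qed.

Lemma eq_located k (s : strategy k) (r r' : nat -> G) t :
  (forall i, i <= t -> r i = r' i) -> located s r t -> located s r' t.
Proof.
move=> rr' loc q qw; rewrite -(rr' t) // -(@eq_answers _ s r r' t.+1) //.
exact: loc.
Qed.

(* The duration of a winning strategy is bounded, by compactness of the set of
   robber walks (Koenig's lemma). *)
Lemma winning_strategy_within k (s : strategy k) :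
  winning_strategy s -> exists m, wins_within s m.
Proof.
move=> win; apply: contrapT => /forallNP nwin.
pose good (n : nat) (q : nat -> G) := forall m, exists r,
  [/\ robber_walk r, forall i, i < n -> r i = q i &
      forall t, t < m -> ~ located s r t].
have good_ext n q : good n q ->
    exists q', good n.+1 q' /\ forall i, i < n -> q' i = q i.
  move=> gq; apply: contrapT => /forallNP bad.
  have /choice[M hM] : forall x : G, exists m, forall r, robber_walk r ->
      (forall i, i < n -> r i = q i) -> r n = x ->
      exists2 t, t < m & located s r t.
    move=> x; pose q' i := if i < n then q i else x.
    have := bad q' => /not_andP[|]; last by case; move=> i; rewrite /q' => ->.
    move=> /existsNP[m hm]; exists m => r rw rq rn.
    apply: contrapT => nloc; apply: hm; exists r; split=> //.
      move=> i; rewrite ltnS leq_eqVlt => /orP[/eqP ->|lt]; rewrite /q'.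
        by rewrite ltnn.
      by rewrite lt rq.
    by move=> t tm lt; apply: nloc; exists t.
  have [r [rw rq nloc]] := gq (\max_x M x).
  have [t tM loc] := hM (r n) r rw rq erefl.
  by apply: nloc loc; apply: leq_trans tM _; apply: leq_bigmax.
have [r0 _] : exists r0 : nat -> G, True.
  have := nwin 0; rewrite /wins_within => /existsNP[r _]; by exists r.
have good0 : good 0 r0.
  move=> m; have := nwin m => /existsNP[r /not_implyP[rw nloc]].
  exists r; split=> // t tm loc; apply: nloc; by exists t.
have /choice[F hF] : forall nq : nat * (nat -> G), exists q', good nq.1 nq.2 ->
    good nq.1.+1 q' /\ forall i, i < nq.1 -> q' i = nq.2 i.
  move=> [n q]; have [gq|] := pselect (good n q); last by exists q.
  by have [q' hq'] := good_ext n q gq; exists q'.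
pose Q := fix Q n := if n is n'.+1 then F (n', Q n') else r0.
have goodQ n : good n (Q n).
  by elim: n => // n IH; have [] := hF (n, Q n) IH.
have QS n i : i < n -> Q n.+1 i = Q n i.
  by have [_] := hF (n, Q n) (goodQ n); exact.
pose r i := Q i.+1 i.
have Qr n i : i < n -> Q n i = r i.
  elim: n => // n IH; rewrite ltnS leq_eqVlt => /orP[/eqP ->//|lt].
  by rewrite QS // IH.
have rw : robber_walk r.
  move=> t; have [p [pw pq _]] := goodQ t.+2 0.
  by rewrite -(Qr t.+2 t) // -(Qr t.+2 t.+1) // -!pq //; apply: pw.
have [t loc] := win r rw.
have [p [pw pq ploc]] := goodQ t.+1 t.+1.
apply: (ploc t) => //; apply: eq_located loc => i it.
by rewrite pq // Qr.
Qed.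

Lemma ex_cops_win_within k : cops_win k -> exists m, `[< cops_win_within k m >].
Proof.
case=> s /winning_strategy_within[m sm]; exists m; apply/asboolP.
by exists s.
Qed.

Definition lcapt_with (k : nat) (win : cops_win k) : nat :=
  ex_minn (ex_cops_win_within win).

Definition lcapt : nat := lcapt_with localization_numberP.

End LocalizationGame.

(* Main.v *)
Require Import Defs.
From mathcomp Require Import all_boot zify.
From mathcomp Require Import boolp.

Set Implicit Arguments.
Unset Strict Implicit.
Unset Printing Implicit Defensive.

(* Upper bound. Root the tree at the root of the copy of T_{3,3} and let the
   lca depth of x and y be the depth of their last common ancestor, so that
   d(x, y) is depth x + depth y minus twice their lca depth. Probing two
   leaves a and b reveals the projection of the robber on the path from a to
   b and its distance to that path: the candidates are then level, and lie
   in branches hanging from a single vertex. As long as two candidates are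
   left, pick x and y among them with minimal lca depth and probe leaves
   below x and y: one move does not bring the robber above the fork of the
   new path, so going up is never confused with going down, and two more
   leaves are discarded. The first probe uses leaves below two children of
   the root and leaves at most l(T) - 4 leaves in play, since each branching
   vertex of the copy carries leaves off the path.

   Lower bound.  One cop never wins, because the robber can keep as candidates
   either two children of the root or the root and a leaf of the copy: for any
   probed vertex c, at most one neighbour of a vertex z is not farther from c
   than z. *)

Lemma last_rev_belast (A : Type) (x : A) p :
  last (last x p) (rev (belast x p)) = x.
Proof. by case: p => //= y p; rewrite rev_cons last_rcons. Qed.

Lemma leq_card_add_imset (I F : finType) (f : I -> F) (A B : {set F})
    (D : {set I}) :
  injective f -> A \subset B -> {in D, forall i, f i \in B :\: A} ->
  #|A| + #|D| <= #|B|.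
Proof.
move=> f_inj AB fD; have disj : A :&: f @: D = set0.
  apply/setP => x; rewrite in_set0; apply/negbTE/negP.
  by case/setIP=> xA /imsetP[i /fD + xi]; rewrite -xi in_setD xA.
rewrite -(card_imset _ f_inj) -cardsUI disj cards0 addn0 subset_leq_card //.
rewrite subUset AB; apply/subsetP => _ /imsetP[i /fD + ->].
by rewrite in_setD => /andP[].
Qed.

Section GraphDistance.
Variable G : sgraph.
Implicit Types (x y z : G) (p : seq G).

Lemma rev_path_adj x p :
  path (@adj G) (last x p) (rev (belast x p)) = path (@adj G) x p.
Proof. by rewrite rev_path; apply: eq_path => y z; rewrite adj_sym. Qed.

Lemma walk_of_length_sym n : symmetric (@walk_of_length G n).
Proof.
suff walk_rev x y : walk_of_length n x y -> walk_of_length n y x.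
  by move=> x y; apply/idP/idP; apply: walk_rev.
move=> /existsP[p /andP[xp /eqP <-]]; apply/existsP.
exists [tuple of rev (belast x p)].
by rewrite /= rev_path_adj xp last_rev_belast /=.
Qed.

Lemma dist_sym : commutative (@dist G).
Proof. by move=> x y; apply: eq_find => n; rewrite walk_of_length_sym. Qed.

Lemma dist_le_size x p : path (@adj G) x p -> dist x (last x p) <= size p.
Proof.
move=> xp; have [p_small|p_big] := ltnP (size p) #|G|; last first.
  by apply: leq_trans p_big; rewrite -[X in _ <= X](size_iota 0) find_size.
rewrite leqNgt; apply/negP => /(before_find 0).
rewrite nth_iota // add0n => /negbT/existsP[].
by exists (in_tuple p); rewrite xp eqxx.
Qed.

Lemma dist_adj x y : adj x y -> dist x y = 1.
Proof.
move=> xy; apply/eqP; rewrite eqn_leq; apply/andP; split.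
  by have := @dist_le_size x [:: y]; rewrite /= xy; apply.
rewrite lt0n; apply: contraTneq xy => /dist_eq0 ->.
by rewrite adj_irr.
Qed.

Lemma acyclic_neighbours_eq z y1 y2 p :
  acyclic G -> adj z y1 -> adj z y2 -> path (@adj G) y1 p ->
  last y1 p = y2 -> z \notin y1 :: p -> y1 = y2.
Proof.
move=> G_acyclic zy1 zy2 yp; have [q yq q_uniq qp] := shortenP yp => qy2 zp.
apply/eqP; apply: contraT => y12.
have zq : z \notin y1 :: q.
  by apply: contra zp; rewrite !inE => /orP[->//|/qp ->]; rewrite orbT.
suff : size (z :: y1 :: q) < 3 by case: (q) qy2 y12 => //= ->; rewrite eqxx.
apply: G_acyclic; rewrite /ucycle /= rcons_path zy1 yq qy2 adj_sym zy2 /=.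
by rewrite zq -/(uniq (y1 :: q)).
Qed.

End GraphDistance.

Section ConnectedDistance.
Variable G : sgraph.
Hypothesis G_connected : connected G.
Implicit Types (c x y z : G).

Lemma geodesic x y :
  exists p, [/\ path (@adj G) x p, last x p = y & size p = dist x y].
Proof.
have [_ /(_ x y)/connectP[p xp ->]] := G_connected.
have [q xq uq _] := shortenP xp.
have q_small : size q < #|G|.
  by have := max_card (mem (x :: q)); rewrite (card_uniqP uq).
have walk_q : has (fun n => walk_of_length n x (last x q)) (iota 0 #|G|).
  apply/hasP; exists (size q); first by rewrite mem_iota.
  by apply/existsP; exists (in_tuple q); rewrite xq eqxx.
have := nth_find 0 walk_q; rewrite -/(dist x (last x q)) nth_iota; last first.
  by move: walk_q; rewrite has_find size_iota.
rewrite add0n => /existsP[w /andP[xw /eqP wq]].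
by exists w; rewrite size_tuple.
Qed.

Lemma dist_triangle x y z : dist x z <= dist x y + dist y z.
Proof.
have [p [xp py <-]] := geodesic x y; have [q [yq qz <-]] := geodesic y z.
by rewrite -size_cat -qz -py -last_cat dist_le_size // cat_path xp py.
Qed.

Lemma dist_adj_leS c x y : adj x y -> dist c y <= (dist c x).+1.
Proof. by move=> /dist_adj xy; rewrite -addn1 -xy dist_triangle. Qed.

Lemma exists_closer c z :
  z != c -> exists2 y, adj z y & dist c z = (dist c y).+1.
Proof.
move=> zc; have [p [cp pz sp]] := geodesic c z.
case/lastP: p cp pz sp => [_ /= cz|p w]; first by rewrite cz eqxx in zc.
rewrite rcons_path last_rcons size_rcons => /andP[cp aw] <- sp.
exists (last c p); first by rewrite adj_sym.
apply/eqP; rewrite eqn_leq dist_adj_leS //= -sp ltnS.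
exact: dist_le_size.
Qed.

Lemma descending_path c z :
  exists p, [/\ path (@adj G) z p, last z p = c
              & {in p, forall y, dist c y < dist c z}].
Proof.
have [n] := ubnP (dist c z); elim: n z => // n IH z; rewrite ltnS => z_near.
have [->|zc] := eqVneq z c; first by exists [::].
have [y zy dz] := exists_closer zc.
have [|p [yp pc p_lt]] := IH y; first by rewrite -dz.
exists (y :: p); split=> //=; first by rewrite zy.
move=> w; rewrite inE => /predU1P[->|/p_lt w_lt]; rewrite dz //.
exact: ltnW.
Qed.

End ConnectedDistance.

Section TreeDistance.
Variable T : sgraph.
Hypothesis T_tree : is_tree T.
Implicit Types (c w x y z : T).

Let T_connected : connected T := proj1 T_tree.

(* Two descending paths to [c] would close up to a cycle through [z]. *)
Lemma closer_unique c z y1 y2 : adj z y1 -> adj z y2 ->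
  dist c y1 <= dist c z -> dist c y2 <= dist c z -> y1 = y2.
Proof.
move=> zy1 zy2 y1_close y2_close.
have [p [yp pc p_lt]] := descending_path T_connected c y1.
have [q [yq qc q_lt]] := descending_path T_connected c y2.
have adj_neq y : adj z y -> z != y by apply: contraTneq => ->; rewrite adj_irr.
apply: (@acyclic_neighbours_eq _ z y1 y2 (p ++ rev (belast y2 q))) => //.
- by case: T_tree.
- by rewrite cat_path yp pc -qc rev_path_adj.
- by rewrite last_cat pc -qc last_rev_belast.
rewrite inE negb_or adj_neq //= mem_cat negb_or mem_rev; apply/andP; split.
  by apply/negP => /p_lt; rewrite ltnNge y1_close.
apply/negP => /mem_belast; rewrite inE (negPf (adj_neq _ zy2)) /= => /q_lt.
by rewrite ltnNge y2_close.
Qed.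

Lemma farther_of_closer c z y1 y2 : adj z y1 -> adj z y2 -> y1 != y2 ->
  dist c y1 <= dist c z -> dist c y2 = (dist c z).+1.
Proof.
move=> zy1 zy2 y12 y1_close; apply/eqP; rewrite eqn_leq dist_adj_leS //= ltnNge.
apply: contra y12 => y2_close.
exact/eqP/(closer_unique zy1 zy2 y1_close y2_close).
Qed.

Lemma dist_adj_cases c x y : adj x y ->
  dist c x = (dist c y).+1 \/ dist c y = (dist c x).+1.
Proof.
move=> xy; have [<-|xc] := eqVneq x c.
  by right; rewrite distxx dist_adj.
have [z xz dz] := exists_closer T_connected xc.
have [yz|zy] := eqVneq z y; first by left; rewrite dz yz.
by right; apply: farther_of_closer xz xy zy _; rewrite dz.
Qed.

Lemma card_farther_neighbours (I : finType) (y : I -> T) c z :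
  injective y -> (forall i, adj z (y i)) ->
  #|I| <= #|[set i | dist c (y i) == (dist c z).+1]|.+1.
Proof.
move=> y_inj zy; set farther := [set i | _].
rewrite -(cardsC farther) -addn1 leq_add2l.
apply/card_le1_eqP => i j; rewrite !inE => i_close j_close; apply: y_inj.
have close k : dist c (y k) != (dist c z).+1 -> dist c (y k) <= dist c z.
  by have [->|->] := dist_adj_cases c (zy k); rewrite ?eqxx.
exact: (closer_unique (zy _) (zy _) (close _ _) (close _ _)).
Qed.

Lemma odd_dist c x y : odd (dist x y) = odd (dist c x) (+) odd (dist c y).
Proof.
have [n] := ubnP (dist x y); elim: n y => // n IH y; rewrite ltnS => y_near.
have [->|yx] := eqVneq y x; first by rewrite distxx addbb.
have [z yz dz] := exists_closer T_connected yx.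
rewrite dz /= IH -?dz //.
by have [->|->] := dist_adj_cases c yz; rewrite /= ?addbN ?negbK.
Qed.

Lemma dist_across_edge x y y' z : adj y y' ->
  dist x y' = (dist x y).+1 -> dist z y = (dist z y').+1 ->
  dist x z = dist x y + dist y z.
Proof.
have [n] := ubnP (dist z y'); elim: n y y' => // n IH y y'.
rewrite ltnS => y'_near yy' xy' zy.
rewrite (dist_sym y) zy; have [<-|y'z] := eqVneq y' z.
  by rewrite distxx addn1.
have [w y'w zy'] := exists_closer T_connected y'z.
have y'y : adj y' y by rewrite adj_sym.
have yw : y != w by apply/eqP => yw; move: zy; rewrite yw zy'; lia.
have xw : dist x w = (dist x y').+1.
  by apply: farther_of_closer y'y y'w yw _; rewrite xy'.
rewrite (IH y' w) ?zy' -1?zy' // xy' (dist_sym y') zy'; lia.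
Qed.

(* Move [y] towards [w] along an edge: either both sides decrease alike, or [y]
   lies on the geodesic from [w] to [x] or to [z]. *)
Lemma dist_four_point w x y z :
  dist x z + dist w y <= maxn (dist x y + dist w z) (dist w x + dist y z).
Proof.
have [n] := ubnP (dist w y); elim: n y => // n IH y; rewrite ltnS => y_near.
have [->|yw] := eqVneq y w.
  by rewrite distxx addn0 (dist_sym w x) maxnn dist_triangle.
have [y' yy' dy] := exists_closer T_connected yw.
have xyz := dist_triangle T_connected x y z.
have [xy'|xy'] := dist_adj_cases x yy'; last first.
  have := dist_across_edge yy' xy' dy.
  rewrite (dist_sym w x) (dist_sym w y); lia.
have [zy'|zy'] := dist_adj_cases z yy'; last first.
  have := dist_across_edge yy' zy' dy.
  rewrite (dist_sym w z) (dist_sym w y) (dist_sym z y); lia.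
have y'_near : dist w y' < n by rewrite -dy.
by have := IH y' y'_near; rewrite (dist_sym y) (dist_sym y'); lia.
Qed.

End TreeDistance.

Section RootedTree.
Variable T : sgraph.
Hypothesis T_tree : is_tree T.
Variable o : T.
Implicit Types (a b l x y z : T) (n : nat).
Local Notation depth := (dist o).

(* The Gromov product.  In a tree it is the depth of the last common ancestor of
   [x] and [y] for the root [o]; the truncated subtraction and the halving are
   then exact, see [dist_lca_depth]. *)
Definition lca_depth x y : nat := (dist o x + dist o y - dist x y)./2.

Lemma lca_depthC x y : lca_depth x y = lca_depth y x.
Proof. by rewrite /lca_depth (dist_sym x y) addnC. Qed.

Lemma lca_depthxx x : lca_depth x x = depth x.
Proof. by rewrite /lca_depth distxx subn0 addnn doubleK. Qed.

Lemma dist_lca_depth x y : dist x y + (lca_depth x y).*2 = depth x + depth y.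
Proof.
have xoy : dist x y <= depth x + depth y.
  by rewrite (dist_sym o x); apply: dist_triangle (proj1 T_tree) _ _ _.
have even_excess : ~~ odd (depth x + depth y - dist x y).
  by rewrite oddB // (odd_dist T_tree o) oddD addbb.
by rewrite /lca_depth halfK (negPf even_excess) subn0 subnKC.
Qed.

Lemma lca_depth_lel x y : lca_depth x y <= depth x.
Proof.
have := dist_lca_depth x y; have := dist_triangle (proj1 T_tree) o x y; lia.
Qed.

Lemma lca_depth_ler x y : lca_depth x y <= depth y.
Proof. by rewrite lca_depthC lca_depth_lel. Qed.

Lemma eq_from_lca_depth x y :
  depth x = depth y -> depth x <= lca_depth x y -> x = y.
Proof. by have := dist_lca_depth x y => xy ? ?; apply: dist_eq0; lia. Qed.

Lemma lca_depth_adj x y : adj x y -> lca_depth x y = minn (depth x) (depth y).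
Proof.
move=> xy; have := dist_lca_depth x y; rewrite (dist_adj xy).
by have [|] := dist_adj_cases T_tree o xy; lia.
Qed.

Lemma lca_depth_ultra x y z :
  minn (lca_depth x y) (lca_depth y z) <= lca_depth x z.
Proof.
have := dist_four_point T_tree o x y z.
have := dist_lca_depth x y; have := dist_lca_depth y z.
have := dist_lca_depth x z; lia.
Qed.

Lemma lca_depth_trans n x y z :
  n <= lca_depth x y -> n <= lca_depth y z -> n <= lca_depth x z.
Proof.
by move=> xy yz; apply: leq_trans (lca_depth_ultra x y z); rewrite leq_min xy.
Qed.

Lemma lca_depth_isosceles x y z :
  lca_depth x y < lca_depth y z -> lca_depth x z = lca_depth x y.
Proof.
move=> xy_lt_yz; apply/eqP; rewrite eqn_leq; apply/andP; split; last first.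
  exact: lca_depth_trans (leqnn _) (ltnW xy_lt_yz).
rewrite leqNgt; apply/negP => xy_lt_xz.
suff : lca_depth x y < lca_depth x y by rewrite ltnn.
by apply: lca_depth_trans xy_lt_xz _; rewrite (lca_depthC z).
Qed.

Lemma lca_depth_descendants x y a b :
  lca_depth x y < lca_depth x a -> lca_depth x y < lca_depth y b ->
  lca_depth a b = lca_depth x y.
Proof.
move=> xa yb; have ay : lca_depth a y = lca_depth x y.
  rewrite (lca_depthC a) (lca_depthC x).
  by rewrite (@lca_depth_isosceles y x) // lca_depthC.
by rewrite (@lca_depth_isosceles a y) ay.
Qed.

Lemma exists_leaf_below x : x != o ->
  exists2 l, l \in leaves T & lca_depth x l = depth x.
Proof.
move=> xo; pose below := [pred l | lca_depth x l == depth x].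
have x_below : below x by rewrite /= lca_depthxx.
case: (@arg_maxnP _ x below depth x_below) => l /eqP xl l_deepest.
exists l => //.
have lo : l != o.
  apply: contra_neq xo => lo; apply/esym/dist_eq0/eqP.
  by rewrite -leqn0 -xl -(distxx o) -{2}lo lca_depth_ler.
have [y ly dl] := exists_closer (proj1 T_tree) lo.
rewrite inE; apply/cards1P; exists y; apply/setP => z; rewrite !inE.
apply/idP/eqP => [lz|->//]; have [dz|dz] := dist_adj_cases T_tree o lz.
  by apply: (closer_unique T_tree lz ly (c := o)); lia.
have z_below : below z.
  rewrite /= eqn_leq lca_depth_lel /=; apply: (@lca_depth_trans _ x l).
    by rewrite xl.
  by rewrite lca_depth_adj // dz -xl; have := lca_depth_ler x l; lia.
by have := l_deepest z z_below; rewrite /= dz ltnn.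
Qed.

End RootedTree.

Section CandidateSets.
Variables (G : sgraph) (k : nat).
Implicit Types (X Y Z : {set G}) (r : nat -> G) (s : strategy G k).
Implicit Types (c : k.-tuple G) (a : k.-tuple nat).

Definition closed_nbhd X : {set G} :=
  [set y | [exists x in X, (y == x) || adj x y]].

Definition probe_answer c (x : G) : k.-tuple nat :=
  [tuple of [seq dist v x | v <- c]].

Definition consistent X c a : {set G} := [set x in X | probe_answer c x == a].

Lemma closed_nbhdP X y :
  reflect (exists2 x, x \in X & y = x \/ adj x y) (y \in closed_nbhd X).
Proof.
rewrite inE; apply: (iffP exists_inP) => -[x xX xy]; exists x => //.
  by case/orP: xy => [/eqP|]; [left|right].
by apply/orP; case: xy => [/eqP|]; [left|right].
Qed.

Lemma sub_closed_nbhd X : X \subset closed_nbhd X.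
Proof. by apply/subsetP => x xX; apply/closed_nbhdP; exists x; [|left]. Qed.

Lemma closed_nbhdS X Y : X \subset Y -> closed_nbhd X \subset closed_nbhd Y.
Proof.
move=> /subsetP XY; apply/subsetP => y /closed_nbhdP[x xX xy].
by apply/closed_nbhdP; exists x; first exact: XY.
Qed.

Lemma consistentS X Y c a :
  X \subset Y -> consistent X c a \subset consistent Y c a.
Proof.
by move=> /subsetP XY; apply/subsetP => x; rewrite !inE => /andP[/XY -> ->].
Qed.

(* [X] is the set of positions which the robber may occupy when the first of the
   [m] remaining probes is made. *)
Fixpoint wins_from m X : Prop :=
  if m is m'.+1 then
    exists c, forall a,
      #|consistent X c a| <= 1 \/ wins_from m' (closed_nbhd (consistent X c a))
  else False.

Definition located_in X s r t : Prop :=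
  forall r', robber_walk r' -> r' 0 \in X ->
    answers s r' t.+1 = answers s r t.+1 -> r' t = r t.

Definition wins_in X s m : Prop :=
  forall r, robber_walk r -> r 0 \in X ->
    exists2 t, t < m & located_in X s r t.

Definition after_answer s a : strategy G k := fun h => s (a :: h).

Lemma answersS s r t a : probe_answer (s [::]) (r 0) = a ->
  answers s r t.+1 = a :: answers (after_answer s a) (r \o succn) t.
Proof.
move=> <-; elim: t => // t IH.
by rewrite -[LHS]/(let h := answers s r t.+1 in
  rcons h (probe_answer (s h) (r t.+1))) IH.
Qed.

Definition start_at (x : G) r : nat -> G :=
  fun t => if t is t'.+1 then r t' else x.

Lemma start_at_walk x r :
  robber_walk r -> r 0 = x \/ adj x (r 0) -> robber_walk (start_at x r).
Proof. by move=> rw xr [|t] //; apply: rw. Qed.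

Lemma shift_walk r : robber_walk r -> robber_walk (r \o succn).
Proof. by move=> rw t; apply: rw. Qed.

Lemma const_walk (x : G) : robber_walk (fun=> x).
Proof. by left. Qed.

Lemma shift_in_closed_nbhd X r :
  robber_walk r -> r 0 \in X -> (r \o succn) 0 \in closed_nbhd X.
Proof. by move=> rw rX; apply/closed_nbhdP; exists (r 0) => //; apply: rw. Qed.

Lemma located_in0 X s r a : r 0 \in X -> probe_answer (s [::]) (r 0) = a ->
  located_in X s r 0 <-> #|consistent X (s [::]) a| <= 1.
Proof.
move=> rX ra; split=> [loc|/card_le1_eqP le1 r' _ r'X].
  suff at_r x : x \in consistent X (s [::]) a -> x = r 0.
    by apply/card_le1_eqP => x y /at_r -> /at_r ->.
  rewrite inE => /andP[xX /eqP xa].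
  apply: (loc (fun=> x)) => //; first exact: const_walk.
  by rewrite (answersS _ ra) (@answersS s (fun=> x) 0 a).
rewrite (answersS _ ra) (answersS _ erefl) => /eqP.
rewrite eqseq_cons => /andP[r'a _].
by apply: le1; rewrite inE ?rX ?ra ?eqxx // r'X.
Qed.

Lemma located_inS X s r t a : probe_answer (s [::]) (r 0) = a ->
  located_in X s r t.+1 <->
  located_in (closed_nbhd (consistent X (s [::]) a)) (after_answer s a)
    (r \o succn) t.
Proof.
move=> ra; split=> loc r' r'w.
  case/closed_nbhdP => x; rewrite inE => /andP[xX /eqP xa] xr' same.
  apply: (loc (start_at x r')) => //; first exact: start_at_walk.
  by rewrite (answersS _ ra) (@answersS s (start_at x r') t.+1 a) // -same.
move=> r'X; rewrite (answersS _ ra) (answersS _ erefl) => /eqP.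
rewrite eqseq_cons => /andP[/eqP r'a /eqP]; rewrite r'a => same.
apply: (loc (r' \o succn)) => //; first exact: shift_walk.
by apply: shift_in_closed_nbhd; rewrite // inE r'X r'a eqxx.
Qed.

Lemma wins_in_after X s m a :
  1 < #|consistent X (s [::]) a| -> wins_in X s m.+1 ->
  wins_in (closed_nbhd (consistent X (s [::]) a)) (after_answer s a) m.
Proof.
move=> undecided win r rw /closed_nbhdP[x]; rewrite inE => /andP[xX /eqP xa] xr.
have [[|t] tm loc] := win _ (start_at_walk rw xr) xX.
  by move: loc => /(located_in0 xX xa); rewrite leqNgt undecided.
by exists t => //; apply/(@located_inS _ _ (start_at x r) t _ xa).
Qed.

Lemma wins_in_of_probe X c m :
  (forall a, #|consistent X c a| <= 1 \/
     exists s, wins_in (closed_nbhd (consistent X c a)) s m) ->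
  exists s, wins_in X s m.+1.
Proof.
move=> win.
have /choice[next nextP] : forall a, exists s, #|consistent X c a| <= 1 \/
    wins_in (closed_nbhd (consistent X c a)) s m.
  move=> a; have [le1|[s sP]] := win a; first by exists (fun=> c); left.
  by exists s; right.
pose s : strategy G k := fun h => if h is a :: h' then next a h' else c.
exists s => r rw rX; have [le1|win_next] := nextP (probe_answer c (r 0)).
  by exists 0 => //; apply/(located_in0 rX erefl).
have [|t tm loc] := win_next _ (shift_walk rw).
  by apply: shift_in_closed_nbhd; rewrite // inE rX eqxx.
by exists t.+1 => //; apply/(located_inS _ _ erefl).
Qed.

Lemma strategy_of_wins_from m X : wins_from m X -> exists s, wins_in X s m.
Proof.
elim: m X => //= m IH X [c win]; apply: (@wins_in_of_probe _ c) => a.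
by have [|/IH] := win a; [left | right].
Qed.

Lemma wins_from_of_strategy s m X : 0 < #|X| -> wins_in X s m -> wins_from m X.
Proof.
elim: m s X => [|m IH] s X X_gt0 win.
  have [x xX] := card_gt0P X_gt0.
  by have [] := win (fun=> x) (const_walk x) xX.
exists (s [::]) => a.
have [_|Y_gt1] := leqP #|consistent X (s [::]) a| 1; [by left | right].
apply: IH (wins_in_after Y_gt1 win).
by apply: leq_trans (subset_leq_card (sub_closed_nbhd _)); apply: ltnW.
Qed.

Lemma wins_in_setT s m : wins_in setT s m <-> wins_within s m.
Proof.
split=> win r rw.
  have [|t tm loc] := win r rw; first exact: in_setT.
  by exists t => // r' r'w; apply: loc; rewrite ?in_setT.
by move=> _; have [t tm loc] := win r rw; exists t => // r' r'w _; apply: loc.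
Qed.

Lemma cops_win_within_of_wins_from m :
  wins_from m setT -> cops_win_within G k m.
Proof. by move/strategy_of_wins_from => [s /wins_in_setT win]; exists s. Qed.

(* Sets in [F] consist of positions possible just after an answer: the robber
   moves once before the next probe. *)
Definition evasive (F : {set G} -> Prop) : Prop :=
  forall X, F X -> 1 < #|X| /\
    forall c, exists a Y, F Y /\ Y \subset consistent (closed_nbhd X) c a.

Lemma evasive_not_cops_win (F : {set G} -> Prop) X :
  evasive F -> F X -> ~ cops_win G k.
Proof.
move=> F_evasive FX.
have survive m Y Z : F Y -> closed_nbhd Y \subset Z -> ~ wins_from m Z.
  elim: m Y Z => [|m IH] Y Z FY YZ [] // c win.
  have [_ /(_ c)[a [Y' [FY' Y'_sub]]]] := F_evasive Y FY.
  have {}Y'_sub := subset_trans Y'_sub (consistentS c a YZ).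
  have [|] := win a; last exact: IH FY' (closed_nbhdS Y'_sub).
  have [Y'_gt1 _] := F_evasive Y' FY'.
  by rewrite leqNgt (leq_trans Y'_gt1) ?subset_leq_card.
move=> /ex_cops_win_within[m /asboolP[s /wins_in_setT]].
have G_gt0 : 0 < #|[set: G]|.
  have [X_gt1 _] := F_evasive X FX.
  exact: leq_trans (ltnW X_gt1) (subset_leq_card (subsetT _)).
by move/(wins_from_of_strategy G_gt0); apply: survive FX (subsetT _).
Qed.

End CandidateSets.

Lemma single_probe_answer_eq (G : sgraph) k (c : k.-tuple G) (v : G) :
  k <= 1 -> exists w, forall x y,
    dist w x = dist w y -> probe_answer c x = probe_answer c y.
Proof.
case: k c => [|[|//]] c _.
  by exists v => x y _; apply: val_inj; rewrite /= tuple0.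
case/tupleP: c => w c; exists w => x y xy; apply: val_inj.
by rewrite /= tuple0 /= xy.
Qed.

Lemma localization_number_le (G : sgraph) k m :
  cops_win_within G k m -> localization_number G <= k.
Proof.
case=> s win; rewrite /localization_number; case: ex_minnP => j _; apply.
by apply/asboolP; exists s => r /win[t _ loc]; exists t.
Qed.

Lemma lcapt_le (G : sgraph) m :
  cops_win_within G (localization_number G) m -> lcapt G <= m.
Proof.
move=> win; rewrite /lcapt /lcapt_with; case: ex_minnP => j _; apply.
exact/asboolP.
Qed.

Section TwoCops.
Variable T : sgraph.
Hypothesis T_tree : is_tree T.
Variable o : T.
Implicit Types (X Y : {set T}) (a b l x y z : T) (e : nat).
Local Notation depth := (dist o).
Local Notation lca := (lca_depth o).

Definition below_fork a b z : bool := lca a b <= minn (lca z a) (lca z b).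

(* The candidates are level, in branches hanging from a vertex of depth [e]. *)
Definition confined e X : Prop :=
  {in X, forall x, e < depth x} /\
  {in X &, forall x y, depth x = depth y /\ e <= lca x y}.

Definition branch_leaves e X : {set T} :=
  [set l in leaves T | [exists x in X, e < lca x l]].

Definition pair_probe a b : 2.-tuple T := [tuple a; b].

Lemma branch_leavesP e X l :
  reflect (l \in leaves T /\ exists2 x, x \in X & e < lca x l)
          (l \in branch_leaves e X).
Proof.
by apply: (iffP setIdP) => -[lT xl]; split=> //; apply/exists_inP.
Qed.

(* Below the fork the smaller of the two depths is the one of the fork, and the
   difference of the distances to [a] and [b] reveals the larger one. *)
Lemma dist_fork_eq a b x y : below_fork a b x -> below_fork a b y ->
  dist a x = dist a y -> dist b x = dist b y ->
  [/\ depth x = depth y, lca x a = lca y a & lca x b = lca y b].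
Proof.
have fork_max z : minn (lca z a) (lca z b) <= lca a b.
  by have := lca_depth_ultra T_tree o a z b; rewrite (lca_depthC o a z).
move: (fork_max x) (fork_max y); rewrite /below_fork => {fork_max}.
have := dist_lca_depth T_tree o x a; have := dist_lca_depth T_tree o y a.
have := dist_lca_depth T_tree o x b; have := dist_lca_depth T_tree o y b.
rewrite !(dist_sym a) !(dist_sym b).
move: (lca x a) (lca y a) (lca x b) (lca y b) (lca a b).
move: (dist x a) (dist y a) (dist x b) (dist y b).
move: (depth x) (depth y) (depth a) (depth b) => {a b x y} *; split; lia.
Qed.

Lemma confined_after_probe X a b k : {in X, forall z, below_fork a b z} ->
  let Y := consistent X (pair_probe a b) k in 1 < #|Y| ->
  exists e, [/\ lca a b <= e, {in Y, forall y, maxn (lca y a) (lca y b) = e}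
              & confined e Y].
Proof.
move=> X_below Y /card_gt1P[y1 [y2 [y1Y y2Y y12]]].
have same x y : x \in Y -> y \in Y ->
    [/\ depth x = depth y, lca x a = lca y a & lca x b = lca y b].
  rewrite !inE => /andP[/X_below x_below /eqP xk].
  move=> /andP[/X_below y_below /eqP yk].
  have [ax bx] : dist a x = dist a y /\ dist b x = dist b y.
    by move: xk; rewrite -yk => /(congr1 val)[].
  exact: dist_fork_eq.
set e := maxn (lca y1 a) (lca y1 b).
have eY y : y \in Y -> maxn (lca y a) (lca y b) = e.
  by move=> yY; have [_ -> ->] := same y y1 yY y1Y.
have e_le x y : x \in Y -> y \in Y -> e <= lca x y.
  move=> xY yY; rewrite -(eY x xY); have [_ xya xyb] := same x y xY yY.
  rewrite geq_max; apply/andP; split.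
    apply: (lca_depth_trans T_tree (y := a)) => //.
    by rewrite (lca_depthC o a) -xya.
  apply: (lca_depth_trans T_tree (y := b)) => //.
  by rewrite (lca_depthC o b) -xyb.
exists e; split=> //.
  have : y1 \in X by move: y1Y; rewrite inE => /andP[].
  by move/X_below/leq_trans; apply; rewrite leq_max geq_minl.
split=> [y yY|x y xY yY]; last first.
  by have [] := same x y xY yY; split; rewrite ?e_le.
have [-> _ _] := same y y1 yY y1Y; rewrite ltnNge; apply: contra y12 => e_big.
have [y12 _ _] := same y1 y2 y1Y y2Y.
by apply/eqP/(eq_from_lca_depth T_tree y12)/(leq_trans e_big)/e_le.
Qed.

Lemma lca_depth_closed_nbhd X z : z \in closed_nbhd X ->
  exists2 x, x \in X &
    minn (depth x) (depth z) <= lca x z /\ depth x <= (depth z).+1.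
Proof.
case/closed_nbhdP=> x xX [->|xz]; exists x => //.
  by rewrite lca_depthxx minnn; split.
rewrite lca_depth_adj //; split=> //; apply: (dist_adj_leS (proj1 T_tree)).
by rewrite adj_sym.
Qed.

Lemma below_fork_closed_nbhd X a b :
  {in X, forall x, lca a b < depth x /\ below_fork a b x} ->
  {in closed_nbhd X, forall z, below_fork a b z}.
Proof.
move=> X_below z /lca_depth_closed_nbhd[x xX [xz depth_xz]].
have [fork_x] := X_below x xX; rewrite /below_fork !leq_min => /andP[xa xb].
have zx : lca a b <= lca z x by rewrite (lca_depthC o z); lia.
by rewrite !(lca_depth_trans T_tree zx).
Qed.

Lemma branch_leaves_closed_nbhd e e' X Y :
  confined e X -> confined e' Y -> e <= e' -> Y \subset closed_nbhd X ->
  branch_leaves e' Y \subset branch_leaves e X.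
Proof.
move=> [X_deep _] [Y_deep _] ee' /subsetP Y_sub.
apply/subsetP => l /branch_leavesP[lT [y yY yl]].
apply/branch_leavesP; split=> //.
have [x xX [xy _]] := lca_depth_closed_nbhd (Y_sub y yY); exists x => //.
apply: (lca_depth_trans T_tree (y := y)); last exact: leq_ltn_trans ee' yl.
by have := X_deep x xX; have := Y_deep y yY; lia.
Qed.

Lemma exists_lowest_fork e X : confined e X -> 1 < #|X| ->
  exists x y, [/\ x \in X, y \in X, {in X &, forall z w, lca x y <= lca z w}
                & {in X, forall z, lca x y < depth z}].
Proof.
move=> [_ X_level] /card_gt1P[x1 [x2 [x1X x2X x12]]].
pose pairs := [pred xy : T * T | (xy.1 \in X) && (xy.2 \in X)].
have pair12 : pairs (x1, x2) by rewrite /= x1X.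
case: (@arg_minnP _ (x1, x2) pairs (fun xy => lca xy.1 xy.2) pair12).
move=> [x y] /= /andP[xX yX] xy_min.
have {}xy_min : {in X &, forall z w, lca x y <= lca z w}.
  by move=> z w zX wX; apply: (xy_min (z, w)); rewrite /= zX.
exists x, y; split=> // z zX; have [<- _] := X_level x1 z x1X zX.
have [x12_level _] := X_level x1 x2 x1X x2X.
rewrite ltnNge; apply: contra x12 => xy_deep.
by apply/eqP/(eq_from_lca_depth T_tree x12_level)/(leq_trans xy_deep)/xy_min.
Qed.

Lemma exists_leaf_fork e X : confined e X -> 1 < #|X| ->
  exists a b, [/\ a \in branch_leaves e X, b \in branch_leaves e X, a != b,
    e <= lca a b & {in X, forall x, lca a b < depth x /\ below_fork a b x}].
Proof.
move=> X_conf X_gt1; have [X_deep X_level] := X_conf.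
have [x [y [xX yX xy_min xy_depth]]] := exists_lowest_fork X_conf X_gt1.
have neq_o z : z \in X -> z != o.
  by move/xy_depth; apply: contraTneq => ->; rewrite distxx.
have [a aT xa] := exists_leaf_below T_tree (neq_o x xX).
have [b bT yb] := exists_leaf_below T_tree (neq_o y yX).
have ab : lca a b = lca x y.
  by apply: lca_depth_descendants; rewrite ?xa ?yb // xy_depth.
exists a, b; rewrite ab; split.
- by apply/branch_leavesP; split=> //; exists x; rewrite // xa X_deep.
- by apply/branch_leavesP; split=> //; exists y; rewrite // yb X_deep.
- apply: contraTneq (xy_depth x xX) => a_eq_b.
  by rewrite -leqNgt -ab a_eq_b lca_depthxx -xa a_eq_b lca_depth_ler.
- by have [_] := X_level x y xX yX.
move=> z zX; split; first exact: xy_depth.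
rewrite /below_fork ab leq_min; apply/andP; split.
  apply: (lca_depth_trans T_tree (xy_min z x zX xX)).
  by rewrite xa ltnW ?xy_depth.
apply: (lca_depth_trans T_tree (xy_min z y zX yX)).
by rewrite yb ltnW ?xy_depth.
Qed.

Lemma confined_probe e X : confined e X -> 1 < #|X| ->
  2 <= #|branch_leaves e X| /\ exists c : 2.-tuple T, forall k,
    let Y := consistent (closed_nbhd X) c k in 1 < #|Y| ->
    exists2 e', confined e' Y
      & #|branch_leaves e' Y| + 2 <= #|branch_leaves e X|.
Proof.
move=> X_conf X_gt1.
have [a [b [aX bX ab e_fork X_below]]] := exists_leaf_fork X_conf X_gt1.
have abX : [set a; b] \subset branch_leaves e X.
  by apply/subsetP => l; rewrite inE => /orP[]/set1P->.
have card_ab : #|[set a; b]| = 2 by rewrite cards2 ab.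
split; first by rewrite -card_ab subset_leq_card.
exists (pair_probe a b) => k Y Y_gt1.
have [e' [fork_e' Y_proj Y_conf]] :=
  confined_after_probe (below_fork_closed_nbhd X_below) Y_gt1.
exists e' => //; rewrite -(cardsID [set a; b] (branch_leaves e X)).
rewrite (setIidPr abX) card_ab addnC leq_add2l subset_leq_card //.
apply/subsetP => l lY; rewrite !inE.
have ee' := leq_trans e_fork fork_e'.
have Y_sub : Y \subset closed_nbhd X.
  by apply/subsetP => y; rewrite inE => /andP[].
have := branch_leaves_closed_nbhd X_conf Y_conf ee' Y_sub.
move/subsetP/(_ l lY); rewrite !inE => ->; rewrite andbT.
case/branch_leavesP: lY => _ [y yY]; rewrite -(Y_proj y yY) ltnNge.
by apply: contra => /orP[]/eqP->; rewrite leq_max leqnn ?orbT.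
Qed.

Lemma confined_wins_from m e X :
  confined e X -> #|branch_leaves e X| <= m.*2.+1 ->
  #|X| <= 1 \/ wins_from 2 m (closed_nbhd X).
Proof.
elim: m e X => [|m IH] e X X_conf few.
  have [_|X_gt1] := leqP #|X| 1; first by left.
  by have [/leq_trans/(_ few)] := confined_probe X_conf X_gt1.
have [_|X_gt1] := leqP #|X| 1; first by left.
have [_ [c c_splits]] := confined_probe X_conf X_gt1; right; exists c => k.
set Y := consistent _ _ _.
have [/c_splits[e' Y_conf fewer]|] := boolP (1 < #|Y|).
  by apply: IH Y_conf _; move: fewer few; rewrite doubleS; lia.
by rewrite -leqNgt; left.
Qed.

End TwoCops.

Section CopyOfT33.
Variable T : sgraph.
Hypothesis T_tree : is_tree T.
Variable f : T33 -> T.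
Hypothesis f_inj : injective f.
Hypothesis f_adj : forall v w : T33, adj v w -> adj (f v) (f w).
Implicit Types (i j : 'I_3) (p q : 'I_3 * 'I_2) (X Y : {set T}).

Definition T33_root : T := f None.
Definition T33_child i : T := f (Some (i, None)).
Definition T33_leaf p : T := f (Some (p.1, Some p.2)).

Local Notation depth := (dist T33_root).
Local Notation lca := (lca_depth T33_root).

Lemma adj_root_child i : adj T33_root (T33_child i).
Proof. exact: f_adj. Qed.

Lemma adj_child_leaf p : adj (T33_child p.1) (T33_leaf p).
Proof. by apply: f_adj; rewrite /= /T33_adj /= eqxx. Qed.

Lemma T33_child_inj : injective T33_child.
Proof. by move=> i j /f_inj[]. Qed.

Lemma T33_leaf_inj : injective T33_leaf.
Proof. by move=> [i k] [j l] /f_inj[/= -> ->]. Qed.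

Lemma root_neq_leaf p : T33_root != T33_leaf p.
Proof. by apply/eqP => /f_inj. Qed.

Lemma equidistant_children c :
  exists i j, i != j /\ dist c (T33_child i) = dist c (T33_child j).
Proof.
have := card_farther_neighbours T_tree c T33_child_inj adj_root_child.
rewrite card_ord ltnS => /card_gt1P[i [j]]; rewrite !inE.
by case=> /eqP ci /eqP cj ij; exists i, j; rewrite ci cj.
Qed.

Lemma leaf_equidistant_from_root c i :
  dist c (T33_child i) < dist c T33_root ->
  exists2 p, p.1 = i & dist c (T33_leaf p) = dist c T33_root.
Proof.
move=> i_close.
have leaf_inj : injective (fun k => T33_leaf (i, k)).
  by move=> k l /T33_leaf_inj[].
have leaf_adj k : adj (T33_child i) (T33_leaf (i, k)) := adj_child_leaf (i, k).
have := card_farther_neighbours T_tree c leaf_inj leaf_adj.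
rewrite card_ord ltnS => /card_gt0P[k]; rewrite inE => /eqP ck.
exists (i, k); rewrite // ck.
have := dist_adj_cases T_tree c (adj_root_child i); lia.
Qed.

Variant evading_pair : T -> T -> Prop :=
  | EvadingChildren i j of i != j : evading_pair (T33_child i) (T33_child j)
  | EvadingRootLeaf p : evading_pair T33_root (T33_leaf p).

Lemma evading_pair_neq x y : evading_pair x y -> x != y.
Proof. by case=> [i j|p]; rewrite ?(inj_eq T33_child_inj) ?root_neq_leaf. Qed.

Lemma evading_pair_step c x y : evading_pair x y -> exists x' y',
  [/\ evading_pair x' y', dist c x' = dist c y'
    & [set x'; y'] \subset closed_nbhd [set x; y]].
Proof.
have adj_nbhd (X : {set T}) v w : v \in X -> adj v w -> w \in closed_nbhd X.
  by move=> vX vw; apply/closed_nbhdP; exists v; [|right].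
case=> [i j ij|p]; last first.
  have [i [j [ij c_ij]]] := equidistant_children c.
  exists (T33_child i), (T33_child j); split=> //; first exact: EvadingChildren.
  by rewrite subUset !sub1set !(adj_nbhd _ T33_root) ?set21 ?adj_root_child.
have [c_ij|c_ij] := eqVneq (dist c (T33_child i)) (dist c (T33_child j)).
  exists (T33_child i), (T33_child j); split=> //; first exact: EvadingChildren.
  exact: sub_closed_nbhd.
have [k k_ij k_close] : exists2 k,
    T33_child k \in [set T33_child i; T33_child j]
    & dist c (T33_child k) < dist c T33_root.
  have := dist_adj_cases T_tree c (adj_root_child i).
  have := dist_adj_cases T_tree c (adj_root_child j).
  have [i_close _ _|i_far] := ltnP (dist c (T33_child i)) (dist c T33_root).
    by exists i; rewrite ?set21.
  by exists j; rewrite ?set22 //; lia.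
have [p p1 c_p] := leaf_equidistant_from_root k_close.
exists T33_root, (T33_leaf p); split=> //; first exact: EvadingRootLeaf.
rewrite subUset !sub1set !(adj_nbhd _ _ _ k_ij) //.
  by rewrite -p1 adj_child_leaf.
by rewrite adj_sym adj_root_child.
Qed.

Lemma cops_win_gt1 k : cops_win T k -> 1 < k.
Proof.
move=> win; rewrite ltnNge; apply/negP => k_le1; move: win.
pose evading X := exists x y, evading_pair x y /\ X = [set x; y].
pose X := [set T33_child ord0; T33_child ord_max].
apply: (@evasive_not_cops_win _ _ evading X) => [_ [x [y [xy ->]]]|].
  split=> [|c]; first by rewrite cards2 evading_pair_neq.
  have [w same_answer] := single_probe_answer_eq c T33_root k_le1.
  have [x' [y' [xy' wxy xy'_sub]]] := evading_pair_step w xy.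
  exists (probe_answer c x'), [set x'; y']; split; first by exists x', y'.
  apply/subsetP => z z_xy; rewrite inE (subsetP xy'_sub) //=.
  by move: z_xy; rewrite !inE => /orP[]/eqP-> //; rewrite (same_answer _ _ wxy).
exists (T33_child ord0), (T33_child ord_max); split=> //.
exact: EvadingChildren.
Qed.

Lemma depth_child i : depth (T33_child i) = 1.
Proof. exact/dist_adj/adj_root_child. Qed.

Lemma depth_leaf p : depth (T33_leaf p) = 2.
Proof.
rewrite -(depth_child p.1); apply: (farther_of_closer T_tree (y1 := T33_root)).
- by rewrite adj_sym adj_root_child.
- exact: adj_child_leaf.
- exact: root_neq_leaf.
- by rewrite distxx.
Qed.

Lemma lca_child_leaf p : lca (T33_child p.1) (T33_leaf p) = 1.
Proof.
by rewrite (lca_depth_adj T_tree _ (adj_child_leaf p)) depth_child depth_leaf.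
Qed.

Lemma lca_leaf_gt0 p q : (0 < lca (T33_leaf p) (T33_leaf q)) = (p.1 == q.1).
Proof.
have lca_leaf_child r : 0 < lca (T33_leaf r) (T33_child r.1).
  by rewrite lca_depthC lca_child_leaf.
apply/idP/eqP => [pq|p1q1].
  apply/T33_child_inj/(eq_from_lca_depth T_tree (o := T33_root));
    rewrite !depth_child //.
  apply: (lca_depth_trans T_tree) (lca_leaf_child q).
  by apply: (lca_depth_trans T_tree) pq; rewrite lca_depthC.
apply: (lca_depth_trans T_tree (lca_leaf_child p)).
by rewrite p1q1 lca_child_leaf.
Qed.

Lemma exists_tips : exists tip : 'I_3 * 'I_2 -> T,
  [/\ injective tip, forall p, tip p \in leaves T
    & forall p q, (0 < lca (tip p) (tip q)) = (p.1 == q.1)].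
Proof.
have /choice[tip tipP] : forall p, exists l,
    l \in leaves T /\ lca (T33_leaf p) l = 2.
  move=> p; have [|l lT] := @exists_leaf_below _ T_tree T33_root (T33_leaf p).
    by rewrite eq_sym root_neq_leaf.
  by rewrite depth_leaf; exists l.
have tip_below p : lca (T33_leaf p) (tip p) = 2 by case: (tipP p).
have lca_lt2 p q : p != q -> lca (T33_leaf p) (T33_leaf q) < 2.
  rewrite ltnNge; apply: contra => pq; apply/eqP/T33_leaf_inj.
  by apply: (eq_from_lca_depth T_tree (o := T33_root)); rewrite !depth_leaf.
have lca_tip p q :
    p != q -> lca (tip p) (tip q) = lca (T33_leaf p) (T33_leaf q).
  by move=> /lca_lt2 pq; apply: lca_depth_descendants; rewrite ?tip_below.
have depth_tip p : 1 < depth (tip p) by rewrite -(tip_below p) lca_depth_ler.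
exists tip; split=> [p q pq|p|p q]; last 2 first.
- by case: (tipP p).
- have [->|pq] := eqVneq p q; first by rewrite lca_depthxx eqxx ltnW ?depth_tip.
  by rewrite lca_tip ?lca_leaf_gt0.
apply/eqP; apply: contraT => p_neq_q; have := lca_lt2 p q p_neq_q.
by rewrite -lca_tip // pq lca_depthxx ltnNge depth_tip.
Qed.

Section FirstProbe.
Variable tip : 'I_3 * 'I_2 -> T.
Hypothesis tip_inj : injective tip.
Hypothesis tip_leaf : forall p, tip p \in leaves T.
Hypothesis lca_tip_gt0 : forall p q, (0 < lca (tip p) (tip q)) = (p.1 == q.1).

Let middle : 'I_3 := lift ord0 ord0.
Let a := tip (ord0, ord0).
Let b := tip (ord_max, ord0).

Lemma card_leaves_ge6 : 6 <= #|leaves T|.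
Proof.
have <- : #|[set: 'I_3 * 'I_2]| = 6 by rewrite cardsT card_prod !card_ord.
rewrite -(card_imset _ tip_inj) subset_leq_card //.
by apply/subsetP => _ /imsetP[p _ ->].
Qed.

Lemma lca_branch_gt0 y p q :
  0 < lca y (tip p) -> (0 < lca y (tip q)) = (p.1 == q.1).
Proof.
rewrite -lca_tip_gt0 => yp.
apply/idP/idP; apply: (lca_depth_trans T_tree) => //.
by rewrite lca_depthC.
Qed.

(* If [e = 0], no candidate lies in the branches of [a] and [b]; if [e > 0],
   none lies in the third branch, and [a] and [b] are excluded as well. *)
Lemma branch_leaves_first_probe e Y :
  {in Y, forall y, maxn (lca y a) (lca y b) = e} ->
  #|branch_leaves T33_root e Y| + 4 <= #|leaves T|.
Proof.
move=> Y_proj.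
suff [D <- D_out] : exists2 D : {set 'I_3 * 'I_2}, #|D| = 4
    & {in D, forall p, tip p \notin branch_leaves T33_root e Y}.
  apply: (leq_card_add_imset tip_inj) => [|p /D_out p_out].
    by apply/subsetP => l /branch_leavesP[].
  by rewrite in_setD p_out tip_leaf.
have [e0|e_gt0] := posnP e.
  have I3_cases (i : 'I_3) : [|| i == ord0, i == middle | i == ord_max].
    by case: i => [[|[|[]]]].
  exists (setX [set~ middle] setT) => [|[i j]].
    by rewrite cardsX cardsC1 cardsT !card_ord.
  rewrite in_setX in_setC1 => /andP[i_side _].
  apply/branch_leavesP => -[_ [y yY]]; rewrite e0 => yp.
  have ya : (0 < lca y a) = (i == ord0) := lca_branch_gt0 (ord0, ord0) yp.
  have yb : (0 < lca y b) = (i == ord_max) := lca_branch_gt0 (ord_max, ord0) yp.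
  have := I3_cases i; rewrite (negPf i_side) -ya -yb.
  by have := Y_proj y yY; lia.
pose D := setX [set middle] [set: 'I_2].
exists ((ord0, ord0) |: ((ord_max, ord0) |: D)) => [|[i j]].
  by rewrite !cardsU1 cardsX cards1 cardsT card_ord !inE.
move=> ijD; apply/branch_leavesP => -[_ [y yY yp]]; have y_proj := Y_proj y yY.
case/setU1P: ijD yp => [->|]; first by rewrite -/a; lia.
case/setU1P => [->|]; first by rewrite -/b; lia.
rewrite in_setX in_set1 => /andP[/eqP-> _] /(leq_ltn_trans (leq0n e)) yp.
have ya : (0 < lca y a) = false := lca_branch_gt0 (ord0, ord0) yp.
have yb : (0 < lca y b) = false := lca_branch_gt0 (ord_max, ord0) yp.
lia.
Qed.

Lemma two_cops_win_within_of_branches :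
  cops_win_within T 2 (#|leaves T| %/ 2 - 1).
Proof.
have -> : #|leaves T| %/ 2 - 1 = (#|leaves T| %/ 2 - 2).+1.
  by have := card_leaves_ge6; lia.
apply: cops_win_within_of_wins_from; exists (pair_probe a b) => k.
set Y := consistent _ _ _; have [Y_gt1|] := boolP (1 < #|Y|); last first.
  by rewrite -leqNgt; left.
have ab : lca a b = 0 by apply/eqP; rewrite -leqn0 leqNgt lca_tip_gt0.
have fork_at_root : {in setT, forall z, below_fork T33_root a b z}.
  by move=> z _; rewrite /below_fork ab.
have [e [_ Y_proj Y_conf]] := confined_after_probe T_tree fork_at_root Y_gt1.
apply: (confined_wins_from T_tree Y_conf).
by have := branch_leaves_first_probe Y_proj; lia.
Qed.

End FirstProbe.

Lemma two_cops_win_within : cops_win_within T 2 (#|leaves T| %/ 2 - 1).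
Proof.
have [tip [tip_inj tip_leaf lca_tip_gt0]] := exists_tips.
exact: two_cops_win_within_of_branches lca_tip_gt0.
Qed.

End CopyOfT33.

Theorem theorem2p3 (T : sgraph) (T_tree : is_tree T)
    (T_T33 : contains_copy T T33) :
  lcapt T <= #|leaves T| %/ 2 - 1.
Proof.
have [f f_inj f_adj] := T_T33.
have two_win := two_cops_win_within T_tree f_inj f_adj.
have loc_gt1 := cops_win_gt1 T_tree f_inj f_adj (localization_numberP T).
suff loc2 : localization_number T = 2 by apply: lcapt_le; rewrite loc2.
by apply/eqP; rewrite eqn_leq (localization_number_le two_win).
Qed.
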